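(* Suppose $A,B\in M_d(\mathbb C)^g$, the set $\{A_1,\dots,A_g\}$ is linearly independent and $p=(p^1,\dots,p^g)$ is a free formal power series map in $x$ (no $x_j^*$) with $p(0)=0$ and $p'(0)=I$. If there exists a $d\times d$ matrix-valued free formal power series $W$ in $x$ such that $$L_B(p(x))=W(x)^*L_A(x)W(x),$$ then $p$ is a convexotonic map $$p(x)=x\,(I-\Lambda_\Xi(x))^{-1}$$ determined by a module spanned by the set $\{A_1,\dots,A_g\}$ over an algebra of dimension at most $g$ with structure matrices $\Xi$; that is, there are an algebra $\mathcal R\subseteq M_d(\mathbb C)$ spanned by matrices $R_1,\dots,R_g$ and a convexotonic tuple $\Xi=(\Xi_1,\dots,\Xi_g)\in M_g(\mathbb C)^g$ such that $A_kR_j=\sum_{s=1}^g(\Xi_j)_{k,s}A_s$ for all $1\le j,k\le g$ and $p(x)=x(I-\Lambda_\Xi(x))^{-1}$.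
   Context: $x=(x_1,\dots,x_g)$ are freely noncommuting variables. For a tuple $A$ of matrices, $\Lambda_A(x)=\sum_jA_jx_j$ and $L_A(x)=I+\Lambda_A(x)+\Lambda_A(x)^*$. Each $p^j$ is a formal power series in $x$ with scalar coefficients; $p(0)=0$, $p'(0)=I$ means $p^j=x_j+(\text{terms of degree}\ge2)$. The identity $L_B(p(x))=W(x)^*L_A(x)W(x)$ is interpreted in the ring of matrices over formal power series in $x,x^*$: writing $\sum_jB_jp^j(x)=\sum_\alpha G_\alpha\alpha$ and $W=\sum_\alpha W_\alpha\alpha$ with $W_\alpha\in M_d(\mathbb C)$, it means that for all words $\alpha,\beta$ and all $1\le j,k\le g$, $W_\beta^*A_k^*W_{x_j\alpha}+W_{x_k\beta}^*A_jW_\alpha+W_{x_k\beta}^*W_{x_j\alpha}=0$, $W_\emptyset^*(A_kW_\alpha+W_{x_k\alpha})=G_{x_k\alpha}$, and $W_\emptyset^*W_\emptyset=I$. A tuple $\Xi\in M_g(\mathbb C)^g$ is convexotonic if $\Xi_k\Xi_j=\sum_s(\Xi_j)_{k,s}\Xi_s$ for all $1\le j,k\le g$. With $x$ viewed as a row vector, $x(I-\Lambda_\Xi(x))^{-1}$ is the row whose $i$-th entry is $\sum_jx_j\big((I-\Lambda_\Xi(x))^{-1}\big)_{j,i}$; such maps are called convexotonic. An algebra here is a (not necessarily unital) subalgebra of $M_d(\mathbb C)$. *)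

(* Defs.v *)
From mathcomp Require Import all_boot all_order all_algebra.
From mathcomp Require Import reals complex.
Set Implicit Arguments.
Unset Strict Implicit.
Unset Printing Implicit Defensive.
Import Order.TTheory GRing.Theory Num.Theory.
Local Open Scope ring_scope.
Local Open Scope complex_scope.
Local Open Scope sesquilinear_scope.

(* A matrix of free formal power series is stored as the family of its matrix
   coefficients, indexed by the words over an alphabet. The words in x are
   [seq 'I_g]; the words in x, x^* are [seq (letter g)], where (j, false) stands
   for x_j and (j, true) for x_j^*. *)
Definition series (R : realType) (L : Type) (m n : nat) : Type :=
  seq L -> 'M[R[i]]_(m, n).

Definition letter (g : nat) : Type := ('I_g * bool)%type.

Section Series.
Variables (R : realType) (L : Type).

Definition sadd m n (f h : series R L m n) : series R L m n :=
  fun w => f w + h w.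

Definition sopp m n (f : series R L m n) : series R L m n := fun w => - f w.

Definition sone n : series R L n n := fun w => if w is [::] then 1%:M else 0.

Definition smul m n p (f : series R L m n) (h : series R L n p) :
    series R L m p :=
  fun w => \sum_(i < (size w).+1) f (take i w) *m h (drop i w).

Definition sinverse n (f h : series R L n n) : Prop :=
  smul f h =1 @sone n /\ smul h f =1 @sone n.

End Series.

Section Star.
Variables (R : realType) (g : nat).

Definition sembed m n (f : series R 'I_g m n) : series R (letter g) m n :=
  fun w => if has snd w then 0 else f (unzip1 w).

Definition wstar (w : seq (letter g)) : seq (letter g) :=
  rev [seq (l.1, ~~ l.2) | l <- w].

Definition sstar m n (f : series R (letter g) m n) : series R (letter g) n m :=
  fun w => (f (wstar w)) ^t*.

End Star.

Section Pencil.
Variables (R : realType) (g : nat).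

(* A free formal power series map with g scalar entries. *)
Definition smap : Type := 'I_g -> seq 'I_g -> R[i].

Definition xvar : smap := fun j w => (w == [:: j])%:R.

(* p(0) = 0 and p'(0) = I *)
Definition normalized (p : smap) : Prop :=
  (forall j, p j [::] = 0) /\ (forall j k, p j [:: k] = (k == j)%:R).

Definition srow (p : smap) : series R 'I_g 1 g := fun w => \row_j p j w.

(* Lambda_A(p(x)) and L_A(p(x)) *)
Definition Lambda d (A : 'I_g -> 'M[R[i]]_d) (p : smap) : series R 'I_g d d :=
  fun w => \sum_j p j w *: A j.

Definition monic_pencil d (A : 'I_g -> 'M[R[i]]_d) (p : smap) :
    series R (letter g) d d :=
  sadd (sadd (@sone R (letter g) d) (sembed (Lambda A p)))
       (sstar (sembed (Lambda A p))).

(* L_B(p(x)) = W(x)^* L_A(x) W(x) *)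
Definition pencil_identity d (A B : 'I_g -> 'M[R[i]]_d) (p : smap)
    (W : series R 'I_g d d) : Prop :=
  monic_pencil B p =1
    smul (smul (sstar (sembed W)) (monic_pencil A xvar)) (sembed W).

Definition convexotonic (Xi : 'I_g -> 'M[R[i]]_g) : Prop :=
  forall j k, Xi k *m Xi j = \sum_s Xi j k s *: Xi s.

(* p(x) = x (I - Lambda_Xi(x))^{-1} *)
Definition convexotonic_map_of (Xi : 'I_g -> 'M[R[i]]_g) (p : smap) : Prop :=
  exists V : series R 'I_g g g,
    sinverse (sadd (@sone R 'I_g g) (sopp (Lambda Xi xvar))) V /\
    srow p =1 smul (srow xvar) V.

Definition subalgebra d (U : {vspace 'M[R[i]]_d}) : Prop :=
  forall X Y, X \in U -> Y \in U -> X *m Y \in U.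

End Pencil.

(* Main.v *)
Require Import Defs.
From mathcomp Require Import all_boot all_order all_algebra.
From mathcomp Require Import reals complex.
Set Implicit Arguments.
Unset Strict Implicit.
Unset Printing Implicit Defensive.
Import Order.TTheory GRing.Theory Num.Theory.
Local Open Scope ring_scope.
Local Open Scope complex_scope.
Local Open Scope sesquilinear_scope.

(** Write W0 for the constant coefficient of W. It is unitary, so the series may
be normalized: M_a = W_a W0^* has M_[::] = 1, and D_s = W0 B_s W0^*. In these
terms the coefficients of the pencil identity say

    A_k M_a + M_{ka} = H_{ka},  where  H_{ka} = sum_s p^s_{ka} D_s,
    M_b^* A_k^* M_{ja} + M_{kb}^* A_j M_a + M_{kb}^* M_{ja} = 0.

Expanding H_{kb}^* H_{ja} and cancelling the second line leaves
(A_k M_b)^* (A_j M_a): the families H_{ja} and A_j M_a have the same Gram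
matrices, so they satisfy the same linear relations with coefficients on the
right ([gram_relation], which is where positivity enters). Two relations are
transferred. Since p'(0) = I, H_k = D_k, so H_{ka} = sum_s p^s_{ka} H_s by
definition, and hence

    A_k M_a = sum_s p^s_{ka} A_s.

Read as a relation among the A_k = A_k M_[::] with right coefficients, this
transfers back to D_k M_a = sum_s p^s_{ka} D_s = H_{ka} = A_k M_a + M_{ka}. So
with R_s = M_{x_s} = D_s - A_s one gets M_{ka} = R_k M_a, that is, M_a is the
word a evaluated at R, and R_k M_a = sum_s p^s_{ka} R_s as well
([normalized_module]).

The rest is algebra. Put (Xi_j)_{k,s} = p^s_{x_k x_j}. The two expansions for
a = x_j say that the span of R is an algebra and that the span of A is a right
module over it, with structure matrices Xi. Evaluating A_k on words in R through
this module structure ([module_word_prod]) and comparing coefficients, which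
linear independence of A permits, gives p^s_{ka} = (Xi^a)_{k,s}, where Xi^a is
the product of the Xi_j along a: this is the expansion of
x (I - Lambda_Xi(x))^{-1}. Convexotonicity of Xi is associativity of the action
of R_k R_j on A. *)

(** * Gram matrices *)

Lemma adjointM (C : numClosedFieldType) m n k (X : 'M[C]_(m, n))
    (Y : 'M[C]_(n, k)) :
  (X *m Y)^t* = Y^t* *m X^t*.
Proof. by rewrite trmx_mul map_mxM. Qed.

Lemma adjointD (C : numClosedFieldType) m n (X Y : 'M[C]_(m, n)) :
  (X + Y)^t* = X^t* + Y^t*.
Proof. by rewrite linearD map_mxD. Qed.

Lemma adjoint_sum (C : numClosedFieldType) m n T (r : seq T)
    (X : T -> 'M[C]_(m, n)) :
  (\sum_(t <- r) X t)^t* = \sum_(t <- r) (X t)^t*.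
Proof. by rewrite !raddf_sum. Qed.

Lemma gram_eq0 (C : numClosedFieldType) m n (X : 'M[C]_(m, n)) :
  X^t* *m X = 0 -> X = 0.
Proof.
move=> X0; apply/matrixP => i j; rewrite [RHS]mxE.
have /eqP := congr1 (fun Y : 'M[C]_n => Y j j) X0.
rewrite !mxE psumr_eq0 => [/allP /(_ i (mem_index_enum i))|k _].
  by rewrite !mxE mulrC mul_conjC_eq0 => /eqP.
by rewrite !mxE mulrC mul_conjC_ge0.
Qed.

(** The Gram matrix of a family determines the norm of each of its combinations,
    hence whether the combination vanishes. The terms of the combination are a
    list because an index may occur more than once. *)
Lemma gram_relation (C : numClosedFieldType) m n k (T : Type)
    (X Y : T -> 'M[C]_(m, n)) (r : seq (T * 'M[C]_(n, k))) :
  (forall s t, (X s)^t* *m X t = (Y s)^t* *m Y t) ->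
  \sum_(u <- r) X u.1 *m u.2 = 0 -> \sum_(u <- r) Y u.1 *m u.2 = 0.
Proof.
move=> XY X0; apply: gram_eq0.
transitivity ((\sum_(u <- r) X u.1 *m u.2)^t* *m \sum_(u <- r) X u.1 *m u.2).
  rewrite !adjoint_sum !mulmx_suml; apply: eq_bigr => u _.
  rewrite !mulmx_sumr; apply: eq_bigr => v _.
  by rewrite !adjointM -!mulmxA; congr (_ *m _); rewrite !mulmxA XY.
by rewrite X0 mulmx0.
Qed.

(** * Products of series *)

Section Products.
Variables (R : realType) (L : Type).
Implicit Types w : seq L.

Lemma smul_cons m n k (f : series R L m n) (h : series R L n k) l w :
  smul f h (l :: w) = f [::] *m h (l :: w) + smul (fun u => f (l :: u)) h w.
Proof. by rewrite /smul big_ord_recl take0 drop0. Qed.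

Lemma smul_rcons m n k (f : series R L m n) (h : series R L n k) l w :
  smul f h (rcons w l) =
    smul f (fun u => h (rcons u l)) w + f (rcons w l) *m h [::].
Proof.
rewrite /smul size_rcons big_ord_recr /=; congr (_ + _); last first.
  by rewrite -(size_rcons w l) take_size drop_size.
apply: eq_bigr => i _; have le_i : (i <= size w)%N by rewrite -ltnS.
by rewrite drop_rcons // -cats1 takel_cat.
Qed.

Lemma smul0l m n k (f : series R L m n) (h : series R L n k) w :
  (forall u, f u = 0) -> smul f h w = 0.
Proof. by move=> f0; apply: big1 => i _; rewrite f0 mul0mx. Qed.

Lemma smul0r m n k (f : series R L m n) (h : series R L n k) w :
  (forall u, h u = 0) -> smul f h w = 0.
Proof. by move=> h0; apply: big1 => i _; rewrite h0 mulmx0. Qed.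

Lemma smul_nil m n k (f : series R L m n) (h : series R L n k) :
  smul f h [::] = f [::] *m h [::].
Proof. by rewrite /smul big_ord1. Qed.

(** Degree at most one. All the explicit factors below, the pencil in x and the
    series I - Lambda(x), have this property, and it reduces a product with
    such a factor to two terms. *)
Definition affine m n (f : series R L m n) : Prop :=
  forall l l' w, f (l :: l' :: w) = 0.

Lemma smul_affinel m n k (f : series R L m n) (h : series R L n k) l w :
  affine f -> smul f h (l :: w) = f [::] *m h (l :: w) + f [:: l] *m h w.
Proof.
move=> aff_f; rewrite smul_cons; congr (_ + _).
by case: w => [|l' w]; rewrite ?smul_nil // smul_cons smul0l ?addr0.
Qed.

Lemma smul_affiner m n k (f : series R L m n) (h : series R L n k) l w :
  affine h ->
  smul f h (rcons w l) = f w *m h [:: l] + f (rcons w l) *m h [::].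
Proof.
move=> aff_h; rewrite smul_rcons; congr (_ + _).
case/lastP: w => [|w l']; rewrite ?smul_nil // smul_rcons smul0r ?add0r //.
by move=> [|l'' [|? ?]] /=; rewrite aff_h.
Qed.

End Products.

(** * Matrix monomials *)

Definition word_prod (C : fieldType) g n (X : 'I_g -> 'M[C]_n) (w : seq 'I_g) :
    'M[C]_n :=
  foldr (fun j M => X j *m M) 1%:M w.

Lemma word_prod_rcons (C : fieldType) g n (X : 'I_g -> 'M[C]_n) w j :
  word_prod X (rcons w j) = word_prod X w *m X j.
Proof. by elim: w => [|k w IHw] /=; rewrite ?mulmx1 ?mul1mx // IHw mulmxA. Qed.

(** If the matrices r act on the span of A on the right through Xi, then words in
    r act through the same words in Xi, in the same order: row k of Xi_j holds
    the coordinates of A_k r_j, so Xi_j multiplies rows on the right, as r_j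
    does. *)
Lemma module_word_prod (C : fieldType) g d (A r : 'I_g -> 'M[C]_d)
    (Xi : 'I_g -> 'M[C]_g) :
  (forall j k, A k *m r j = \sum_s Xi j k s *: A s) ->
  forall w k, A k *m word_prod r w = \sum_s word_prod Xi w k s *: A s.
Proof.
move=> Ar; elim=> [|j w IHw] k /=.
  rewrite mulmx1 (bigD1 k) //= mxE eqxx scale1r big1 ?addr0 // => s s_k.
  by rewrite mxE eq_sym (negPf s_k) scale0r.
rewrite mulmxA Ar mulmx_suml.
under [LHS]eq_bigr => s _ do rewrite -scalemxAl IHw scaler_sumr.
rewrite exchange_big; apply: eq_bigr => s _.
by rewrite mxE scaler_suml; apply: eq_bigr => t _; rewrite scalerA.
Qed.

Lemma free_coef (C : fieldType) (V : vectType C) g (A : 'I_g -> V)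
    (c c' : 'I_g -> C) :
  free [tuple A j | j < g] ->
  \sum_s c s *: A s = \sum_s c' s *: A s -> c =1 c'.
Proof.
move=> /freeP freeA eq_cc' s; apply/eqP; rewrite -subr_eq0; apply/eqP.
apply: (freeA (fun s => c s - c' s)).
under [LHS]eq_bigr => t _ do rewrite -tnth_nth tnth_mktuple scalerBl.
by rewrite sumrB eq_cc' addrN.
Qed.

Lemma subalgebra_span (R : realType) g d (r : 'I_g -> 'M[R[i]]_d)
    (Xi : 'I_g -> 'M[R[i]]_g) :
  (forall j k, r k *m r j = \sum_s Xi j k s *: r s) ->
  subalgebra <<[tuple r j | j < g]>>%VS.
Proof.
move=> rr; have mem_r s : r s \in <<[tuple r j | j < g]>>%VS.
  by apply: memv_span; apply/mapP; exists s; rewrite ?mem_enum.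
move=> X Y /coord_span -> /coord_span ->.
rewrite mulmx_suml; apply: memv_suml => k _.
rewrite mulmx_sumr; apply: memv_suml => j _.
rewrite -!tnth_nth !tnth_mktuple -scalemxAl -scalemxAr rr !memvZ //.
by apply: memv_suml => s _; rewrite memvZ.
Qed.

(** * Geometric series *)

Section GeometricSeries.
Variables (R : realType) (g n : nat) (X : 'I_g -> 'M[R[i]]_n).

Lemma affine_Lambda : affine (Lambda X (@xvar R g)).
Proof. by move=> l l' w; apply: big1 => j _; rewrite /xvar eqseq_cons andbF scale0r. Qed.

Lemma Lambda_letter j : Lambda X (@xvar R g) [:: j] = X j.
Proof.
rewrite /Lambda (bigD1 j) //= /xvar eqxx scale1r big1 ?addr0 // => k k_j.
by rewrite eqseq_cons andbT eq_sym (negPf k_j) scale0r.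
Qed.

Lemma Lambda_nil : Lambda X (@xvar R g) [::] = 0.
Proof. by apply: big1 => j _; rewrite scale0r. Qed.

(** Both factorizations of a nonempty word, by its first and by its last letter,
    are needed: they give the two sides of the inverse. *)
Lemma geometric_sinverse :
  sinverse (sadd (@sone R 'I_g n) (sopp (Lambda X (@xvar R g)))) (word_prod X).
Proof.
set D := sadd _ _.
have affD : affine D.
  by move=> l l' w; rewrite /D /sadd /sopp affine_Lambda oppr0 addr0.
have D0 : D [::] = 1%:M by rewrite /D /sadd /sopp Lambda_nil oppr0 addr0.
have D1 j : D [:: j] = - X j by rewrite /D /sadd /sopp Lambda_letter add0r.
split=> w.
  case: w => [|j w]; first by rewrite smul_nil D0 mul1mx.
  by rewrite smul_affinel // D0 D1 mul1mx mulNmx addrN.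
case/lastP: w => [|w j]; first by rewrite smul_nil D0 mulmx1.
rewrite smul_affiner // D0 D1 mulmx1 mulmxN word_prod_rcons addNr.
by case: w.
Qed.

End GeometricSeries.

(** * Coefficients of the pencil identity *)

Section Coefficients.
Variables (R : realType) (g : nat).

(** star_word b ++ plain_word a encodes the monomial b^* a; only
    such monomials occur in W(x)^* L_A(x) W(x). *)
Definition plain_word (a : seq 'I_g) : seq (letter g) := [seq (j, false) | j <- a].
Definition star_word (b : seq 'I_g) : seq (letter g) :=
  rev [seq (j, true) | j <- b].

Lemma has_plain (a : seq 'I_g) : has snd (plain_word a) = false.
Proof. by elim: a. Qed.

Lemma all_star (b : seq 'I_g) : all snd (star_word b).
Proof. by rewrite all_rev; elim: b. Qed.

Lemma star_word_cons (k : 'I_g) b : star_word (k :: b) = rcons (star_word b) (k, true).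
Proof. by rewrite /star_word /= rev_cons. Qed.

Lemma sembed_plain m n (f : series R 'I_g m n) a :
  sembed f (plain_word a) = f a.
Proof. by rewrite /sembed has_plain; congr f; elim: a => //= j a ->. Qed.

Lemma sembed_cons m n (f : series R 'I_g m n) j a :
  sembed f ((j, false) :: plain_word a) = f (j :: a).
Proof. exact: (sembed_plain f (j :: a)). Qed.

Lemma wstar_star (b : seq 'I_g) : wstar (star_word b) = plain_word b.
Proof. by rewrite /wstar /star_word map_rev revK -map_comp. Qed.

Lemma has_wstar (w : seq (letter g)) : has snd (wstar w) = ~~ all snd w.
Proof. by rewrite has_rev has_map -has_predC. Qed.

Lemma sstar_star m n (f : series R 'I_g m n) b :
  sstar (sembed f) (star_word b) = (f b)^t*.
Proof. by rewrite /sstar wstar_star sembed_plain. Qed.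

Lemma sembed0 m n (f : series R 'I_g m n) w : has snd w -> sembed f w = 0.
Proof. by rewrite /sembed => ->. Qed.

Lemma sstar0 m n (f : series R 'I_g m n) w :
  ~~ all snd w -> sstar (sembed f) w = 0.
Proof. by rewrite /sstar -has_wstar => /sembed0 ->; rewrite trmx0 map_mx0. Qed.

(** A series in x alone cannot absorb a starred letter, so a starred prefix
    belongs entirely to the left factor. *)
Lemma smul_star_prefix m n k (F : series R (letter g) m n)
    (h : series R 'I_g n k) b w :
  all snd b ->
  smul F (sembed h) (b ++ w) = smul (fun u => F (b ++ u)) (sembed h) w.
Proof.
elim: b F => [|l b IHb] F //= /andP[sl sb].
by rewrite smul_cons sembed0 /= ?sl // mulmx0 add0r IHb.
Qed.

Variables (d : nat) (A : 'I_g -> 'M[R[i]]_d).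

Local Notation LA := (monic_pencil A (@xvar R g)).

Lemma pencil_plain (p : smap R g) (X : 'I_g -> 'M[R[i]]_d) k a :
  monic_pencil X p (plain_word (k :: a)) = Lambda X p (k :: a).
Proof. by rewrite /monic_pencil /sadd sembed_plain sstar0 //= add0r addr0. Qed.

Lemma pencil_mixed (p : smap R g) (X : 'I_g -> 'M[R[i]]_d) k b j a :
  monic_pencil X p (star_word (k :: b) ++ plain_word (j :: a)) = 0.
Proof.
rewrite /monic_pencil /sadd sembed0 ?sstar0.
- by rewrite star_word_cons; case: (star_word b) => /=; rewrite !addr0.
- by rewrite all_cat /= andbF.
by rewrite has_cat star_word_cons has_rcons.
Qed.

Lemma pencil_nil (p : smap R g) (X : 'I_g -> 'M[R[i]]_d) :
  (forall j, p j [::] = 0) -> monic_pencil X p [::] = 1%:M.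
Proof.
move=> p0; have L0 : Lambda X p [::] = 0.
  by apply: big1 => j _; rewrite p0 scale0r.
by rewrite /monic_pencil /sadd /sstar /sembed /= L0 trmx0 map_mx0 !addr0.
Qed.

Lemma LA_nil : LA [::] = 1%:M.
Proof. exact: pencil_nil. Qed.

Lemma LA_plain j : LA [:: (j, false)] = A j.
Proof. by rewrite -[RHS]Lambda_letter -pencil_plain. Qed.

Lemma LA_star k : LA [:: (k, true)] = (A k)^t*.
Proof.
rewrite /monic_pencil /sadd sembed0 // !add0r.
by rewrite -[in RHS](Lambda_letter A k) -sstar_star.
Qed.

Lemma affine_LA : affine LA.
Proof.
have L0 l l' w : sembed (Lambda A (@xvar R g)) (l :: l' :: w) = 0.
  by rewrite /sembed; case: ifP => //= _; rewrite affine_Lambda.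
move=> l l' w; rewrite /monic_pencil /sadd L0 /sstar.
set u := wstar _; have : size u = (size w).+2 by rewrite size_rev size_map.
by case: u => [|l1 [|l2 u]] // _; rewrite L0 trmx0 map_mx0 !addr0.
Qed.

Variable W : series R 'I_g d d.

Local Notation WA := (smul (sstar (sembed W)) LA).

(** The linear part of L_A(x) meets at most one plain letter, and W(x)^* none; so
    beyond a starred prefix the left factor W(x)^* L_A(x) takes either no letter
    or just the first one. *)
Lemma smul_pencil_plain b j a :
  all snd b ->
  smul WA (sembed W) (b ++ plain_word (j :: a)) =
    WA b *m W (j :: a) + WA (rcons b (j, false)) *m W a.
Proof.
move=> sb; rewrite smul_star_prefix // [plain_word _]/= -/(plain_word a).
rewrite smul_cons cats0 sembed_cons; congr (_ + _).
case: a => [|k a].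
  by rewrite smul_nil cats1 (sembed_plain W [::]).
rewrite [plain_word _]/= -/(plain_word a) smul_cons cats1 sembed_cons.
(* A left factor with two plain letters has coefficient 0. *)
rewrite [X in _ + X]smul0l ?addr0 // => u; case/lastP: u => [|u l].
  rewrite -cat_rcons cats1 smul_affiner; last exact: affine_LA.
  by rewrite !sstar0 ?mul0mx ?addr0 ?all_rcons.
rewrite -2!rcons_cons -rcons_cat smul_affiner; last exact: affine_LA.
by rewrite !sstar0 ?mul0mx ?addr0 // ?all_rcons !all_cat /= !andbF.
Qed.

Lemma WA_nil : WA [::] = (W [::])^t*.
Proof. by rewrite smul_nil LA_nil mulmx1 -sstar_star. Qed.

Lemma WA_star k b :
  WA (star_word (k :: b)) = (W b)^t* *m (A k)^t* + (W (k :: b))^t*.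
Proof.
rewrite star_word_cons smul_affiner; last exact: affine_LA.
by rewrite -star_word_cons LA_nil LA_star !sstar_star mulmx1.
Qed.

Lemma WA_star_plain b j :
  WA (rcons (star_word b) (j, false)) = (W b)^t* *m A j.
Proof.
rewrite smul_affiner; last exact: affine_LA.
by rewrite LA_nil LA_plain sstar_star sstar0 ?mul0mx ?addr0 // all_rcons.
Qed.

Variables (B : 'I_g -> 'M[R[i]]_d) (p : smap R g).
Hypothesis p0 : forall j, p j [::] = 0.
Hypothesis WAW : pencil_identity A B p W.

Lemma coef_nil : (W [::])^t* *m W [::] = 1%:M.
Proof.
have := WAW [::]; rewrite pencil_nil // smul_nil WA_nil => ->.
by rewrite (sembed_plain W [::]).
Qed.

Lemma coef_plain k a :
  (W [::])^t* *m (A k *m W a + W (k :: a)) = \sum_s p s (k :: a) *: B s.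
Proof.
rewrite -[RHS]/(Lambda B p (k :: a)) -pencil_plain WAW.
rewrite (smul_pencil_plain (b := [::])) // WA_nil (WA_star_plain [::]).
by rewrite mulmxDr mulmxA addrC.
Qed.

Lemma coef_mixed k b j a :
  (W b)^t* *m (A k)^t* *m W (j :: a) + (W (k :: b))^t* *m A j *m W a
    + (W (k :: b))^t* *m W (j :: a) = 0.
Proof.
have := WAW (star_word (k :: b) ++ plain_word (j :: a)).
rewrite pencil_mixed smul_pencil_plain ?all_star // WA_star WA_star_plain.
by move=> ->; rewrite mulmxDl addrAC.
Qed.

End Coefficients.

(** * The unitary normalization *)

Section Normalization.
Variables (C : numClosedFieldType) (g d : nat) (A B : 'I_g -> 'M[C]_d).
Variables (p : 'I_g -> seq 'I_g -> C) (W : seq 'I_g -> 'M[C]_d).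

Hypothesis p1 : forall j k, p j [:: k] = (k == j)%:R.
Hypothesis W_nil : (W [::])^t* *m W [::] = 1%:M.
Hypothesis W_plain : forall k a,
  (W [::])^t* *m (A k *m W a + W (k :: a)) = \sum_s p s (k :: a) *: B s.
Hypothesis W_mixed : forall k b j a,
  (W b)^t* *m (A k)^t* *m W (j :: a) + (W (k :: b))^t* *m A j *m W a
    + (W (k :: b))^t* *m W (j :: a) = 0.

Let U := W [::].
Let M a := W a *m U^t*.
Let D s := U *m B s *m U^t*.
Let H k a := A k *m M a + M (k :: a).

Let UU : U *m U^t* = 1%:M. Proof. exact: mulmx1C W_nil. Qed.

Let M_nil : M [::] = 1%:M. Proof. exact: UU. Qed.

Let H_expansion k a : H k a = \sum_s p s (k :: a) *: D s.
Proof.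
rewrite /H /M mulmxA -mulmxDl -[_ + _]mul1mx -UU -[U *m _ *m _]mulmxA W_plain.
rewrite mulmx_sumr mulmx_suml; apply: eq_bigr => s _.
by rewrite -scalemxAr -scalemxAl.
Qed.

Let sum_delta (X : 'I_g -> 'M[C]_d) k : \sum_s p s [:: k] *: X s = X k.
Proof.
rewrite (bigD1 k) //= p1 eqxx scale1r big1 ?addr0 // => s s_k.
by rewrite p1 eq_sym (negPf s_k) scale0r.
Qed.

Let H_letter k : H k [::] = D k.
Proof. by rewrite H_expansion sum_delta. Qed.

Let M_mixed k b j a :
  (M b)^t* *m (A k)^t* *m M (j :: a) + (M (k :: b))^t* *m A j *m M a
    + (M (k :: b))^t* *m M (j :: a) = 0.
Proof.
rewrite /M !adjointM trmxCK !mulmxA -!mulmxDl -!mulmxA -!mulmxDr !mulmxA.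
by rewrite W_mixed mulmx0 mul0mx.
Qed.

(** H_{kb}^* H_{ja} expands into (A_k M_b)^* (A_j M_a) and three further terms,
    whose sum is the vanishing mixed coefficient. *)
Let gram_H s t :
  (A s.1 *m M s.2)^t* *m (A t.1 *m M t.2) = (H s.1 s.2)^t* *m H t.1 t.2.
Proof.
case: s t => [k b] [j a] /=.
rewrite /H; move: (M_mixed k b j a).
move: (M (k :: b)) (M (j :: a)) (M b) (M a) => Mkb Mja Mb Ma mixed.
rewrite adjointD mulmxDl !mulmxDr adjointM -addrA !mulmxA.
by rewrite -[LHS]addr0 -mixed !addrA.
Qed.

(** The terms of the relation X_(k,a') K - sum_s p^s_{ka} X_(s,[::]) = 0 among
    matrices X indexed by nonempty words, split into first letter and rest. *)
Let expansion_terms k a (K : 'M[C]_d) (a' : seq 'I_g) :=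
  ((k, a'), K) :: [seq ((s, [::]), - (p s (k :: a))%:M) | s <- index_enum 'I_g].

Let sum_expansion_terms (X : 'I_g * seq 'I_g -> 'M[C]_d) k a K a' :
  \sum_(u <- expansion_terms k a K a') X u.1 *m u.2 =
    X (k, a') *m K - \sum_s p s (k :: a) *: X (s, [::]).
Proof.
rewrite big_cons big_map /= -sumrN; congr (_ + _); apply: eq_bigr => s _.
by rewrite mulmxN mul_mx_scalar.
Qed.

Let transfer (X Y : 'I_g * seq 'I_g -> 'M[C]_d) k a K a' :
  (forall s t, (X s)^t* *m X t = (Y s)^t* *m Y t) ->
  X (k, a') *m K = \sum_s p s (k :: a) *: X (s, [::]) ->
  Y (k, a') *m K = \sum_s p s (k :: a) *: Y (s, [::]).
Proof.
move=> XY /eqP; rewrite -subr_eq0 -sum_expansion_terms => /eqP.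
move=> /(gram_relation XY); rewrite sum_expansion_terms.
by move=> /eqP; rewrite subr_eq0 => /eqP.
Qed.

Let X (t : 'I_g * seq 'I_g) := A t.1 *m M t.2.
Let Y (t : 'I_g * seq 'I_g) := H t.1 t.2.

Let X_letter s : X (s, [::]) = A s.
Proof. by rewrite /X M_nil mulmx1. Qed.

(** Transfer of the expansion of H_{ka} in the H_s; the right coefficients are
    scalars and the distinguished index is (k, a). *)
Let module_expansion k a : A k *m M a = \sum_s p s (k :: a) *: A s.
Proof.
under eq_bigr do rewrite -X_letter.
rewrite -[LHS]mulmx1.
apply: (transfer (X := Y) (Y := X) (a' := a)) => [s t|]; first exact/esym/gram_H.
rewrite mulmx1 /Y H_expansion.
by apply: eq_bigr => s _; rewrite H_letter.
Qed.

(** Transfer in the other direction, now with the right coefficient M_a at the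
    index (k, [::]): the same relation as [module_expansion], read among the A_s
    only. *)
Let conjugate_expansion k a : D k *m M a = \sum_s p s (k :: a) *: D s.
Proof.
under eq_bigr do rewrite -H_letter.
rewrite -H_letter.
apply: (transfer (X := X) (Y := Y) (a' := [::])) => [s t|]; first exact: gram_H.
rewrite X_letter module_expansion.
by apply: eq_bigr => s _; rewrite X_letter.
Qed.

Let M_letter k : M [:: k] = D k - A k.
Proof. by rewrite -H_letter /H M_nil mulmx1 addrC addKr. Qed.

Let M_cons k a : M (k :: a) = M [:: k] *m M a.
Proof.
rewrite M_letter mulmxBl conjugate_expansion -H_expansion.
by rewrite /H addrC addKr.
Qed.

Let M_expansion k a : M (k :: a) = \sum_s p s (k :: a) *: M [:: s].
Proof.
rewrite M_cons M_letter mulmxBl conjugate_expansion module_expansion -sumrB.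
by apply: eq_bigr => s _; rewrite M_letter scalerBr.
Qed.

(** What the analytic hypotheses leave behind: W disappears, and p records how
    words in r act on A and on r itself. *)
Lemma normalized_module :
  exists r : 'I_g -> 'M[C]_d,
    (forall k a, A k *m word_prod r a = \sum_s p s (k :: a) *: A s) /\
    (forall k a, r k *m word_prod r a = \sum_s p s (k :: a) *: r s).
Proof.
exists (fun s => M [:: s]).
have M_word a : word_prod (fun s => M [:: s]) a = M a.
  by elim: a => [|k a IHa] /=; rewrite ?M_nil // IHa -M_cons.
split=> k a; rewrite M_word; first exact: module_expansion.
by rewrite -M_cons M_expansion.
Qed.

End Normalization.

(** * Module structure and the convexotonic map *)

Theorem theorem1p12 (R : realType) (d g : nat) (A B : 'I_g -> 'M[R[i]]_d)
  (p : smap R g)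
  (hA : free [tuple A j | j < g])
  (hp : normalized p)
  (hW : exists W : series R 'I_g d d, pencil_identity A B p W) :
  exists (U : {vspace 'M[R[i]]_d}) (r : 'I_g -> 'M[R[i]]_d)
         (Xi : 'I_g -> 'M[R[i]]_g),
    [/\ subalgebra U,
        U = <<[tuple r j | j < g]>>%VS,
        convexotonic Xi,
        forall j k, A k *m r j = \sum_s Xi j k s *: A s
      & convexotonic_map_of Xi p].
Proof.
case: hp => p0 p1; case: hW => W WAW.
have [r [Ar rr]] := normalized_module p1 (coef_nil p0 WAW)
  (coef_plain WAW) (coef_mixed WAW).
pose Xi j : 'M[R[i]]_g := \matrix_(k, s) p s [:: k; j].
have Ar1 j k : A k *m r j = \sum_s Xi j k s *: A s.
  have := Ar k [:: j]; rewrite /= mulmx1 => ->; apply: eq_bigr => s _; by rewrite mxE.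
have rr1 j k : r k *m r j = \sum_s Xi j k s *: r s.
  have := rr k [:: j]; rewrite /= mulmx1 => ->; apply: eq_bigr => s _; by rewrite mxE.
have p_word k a s : p s (k :: a) = word_prod Xi a k s.
  apply: (free_coef hA (c := fun t => p t (k :: a))).
  by rewrite -Ar (module_word_prod Ar1).
exists <<[tuple r j | j < g]>>%VS, r, Xi; split=> //.
- exact: subalgebra_span rr1.
- move=> j k; apply/matrixP => m s; apply: (free_coef hA (c := (Xi k *m Xi j) m)).
  (* Both sides expand A_m r_k r_j over A: let r_k and r_j act in turn,
     or expand r_k r_j first. *)
  transitivity (A m *m (r k *m r j)).
    by have := module_word_prod Ar1 [:: k; j] m; rewrite /= !mulmx1 => ->.
  rewrite rr1 mulmx_sumr.
  under [LHS]eq_bigr => t _ do rewrite -scalemxAr Ar1 scaler_sumr.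
  rewrite exchange_big; apply: eq_bigr => t _.
  by rewrite summxE scaler_suml; apply: eq_bigr => u _; rewrite scalerA [in RHS]mxE.
exists (word_prod Xi); split; first exact: geometric_sinverse.
have x0 : srow (@xvar R g) [::] = 0 by apply/matrixP => i s; rewrite !mxE.
have affx : affine (srow (@xvar R g)).
  by move=> l l' w; apply/matrixP => i s; rewrite !mxE /xvar eqseq_cons andbF.
have x1 k : srow (@xvar R g) [:: k] = delta_mx 0 k.
  by apply/matrixP => i s; rewrite !mxE /xvar eqseq_cons andbT ord1 eqxx eq_sym.
case=> [|k a].
  by rewrite smul_nil x0 mul0mx; apply/matrixP => i s; rewrite !mxE p0.
rewrite smul_affinel // x0 mul0mx add0r x1 -rowE.
by apply/matrixP => i s; rewrite !mxE p_word.
Qed.
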